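(* Let $k$ be a field, let $L$ be a Lie algebra over $k$, and let $r\in L\otimes L$ be strongly symmetric. Then $r$ is a solution of the classical Yang-Baxter equation (CYBE) in $L$.
   Context: All tensor products are over the field $k$ (of arbitrary characteristic); $L$ is of arbitrary dimension. Strongly symmetric: let $V$ be a $k$-vector space with basis $\{e_i \mid i\in\Omega\}$ and let $r=\sum_{i,j\in\Omega}k_{ij}(e_i\otimes e_j)\in V\otimes V$ with $k_{ij}\in k$ (finitely many nonzero). Then $r$ is called strongly symmetric (to the basis $\{e_i\}$) if $k_{ij}=k_{ji}$ and $k_{ij}k_{lm}=k_{il}k_{jm}$ for all $i,j,l,m\in\Omega$. (This property does not depend on the choice of basis.) CYBE: for $r=\sum_i a_i\otimes b_i\in L\otimes L$, put $[r^{12},r^{13}]=\sum_{i,j}[a_i,a_j]\otimes b_i\otimes b_j$, $[r^{12},r^{23}]=\sum_{i,j}a_i\otimes[b_i,a_j]\otimes b_j$, $[r^{13},r^{23}]=\sum_{i,j}a_i\otimes a_j\otimes[b_i,b_j]$. Then $r$ is a solution of CYBE in $L$ if $[r^{12},r^{13}]+[r^{12},r^{23}]+[r^{13},r^{23}]=0$. *)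

(* Defs.v *)
From HB Require Import structures.
From mathcomp Require Import all_boot all_order all_algebra.
From mathcomp Require Import finmap.
From mathcomp Require Import boolp.
From mathcomp Require Import monalg.

Set Implicit Arguments.
Unset Strict Implicit.
Unset Printing Implicit Defensive.

Import GRing.Theory.
Local Open Scope ring_scope.
Local Open Scope quotient_scope.

(* Lie algebras, of arbitrary dimension and in arbitrary characteristic: the
   bracket is alternating, not merely skew-symmetric. *)
HB.mixin Record Lmodule_isLie (k : fieldType) V of GRing.Lmodule k V := {
  lie : V -> V -> V;
  lie_linearl : forall z, linear (fun x => lie x z);
  lie_linearr : forall x, linear (lie x);
  liexx : forall x, lie x x = 0;
  lie_jacobi : forall x y z,
    lie x (lie y z) + lie y (lie z x) + lie z (lie x y) = 0
}.

#[short(type="lieAlgType")]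
HB.structure Definition LieAlgebra (k : fieldType) :=
  { V of GRing.Lmodule k V & Lmodule_isLie k V }.

(* V (x) W is the free vector space {malg k[V * W]} on the set V * W modulo the
   subspace spanned by the bilinearity relations; << (v, w) >> is the free
   generator indexed by (v, w). *)
Section Tensor.
Context (k : fieldType) (V W : lmodType k).

Local Notation free := {malg k[((V * W)%type)]}.

Inductive tensor_rel : free -> Prop :=
| TensorRel0 : tensor_rel 0
| TensorRelP (c : k) (x y : free) :
    tensor_rel x -> tensor_rel y -> tensor_rel (c *: x + y)
| TensorRelL (c : k) (v v' : V) (w : W) :
    tensor_rel (<< (c *: v + v', w) >> - (c *: << (v, w) >> + << (v', w) >>))
| TensorRelR (c : k) (v : V) (w w' : W) :
    tensor_rel (<< (v, c *: w + w') >> - (c *: << (v, w) >> + << (v, w') >>)).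

Definition tensor_ker : {pred free} := fun x => `[< tensor_rel x >].

Lemma tensor_kerP x : reflect (tensor_rel x) (x \in tensor_ker).
Proof. exact: asboolP. Qed.

Lemma tensor_kerZ c x : x \in tensor_ker -> c *: x \in tensor_ker.
Proof.
move=> /tensor_kerP xP; apply/tensor_kerP; rewrite -[_ *: _]addr0.
by apply: TensorRelP => //; apply: TensorRel0.
Qed.

Fact tensor_ker_zmod_closed : zmod_closed tensor_ker.
Proof.
split=> [|x y /tensor_kerP xP /tensor_kerP yP]; apply/tensor_kerP.
  exact: TensorRel0.
by rewrite addrC -scaleN1r; apply: TensorRelP.
Qed.

HB.instance Definition _ :=
  GRing.isZmodClosed.Build free tensor_ker tensor_ker_zmod_closed.

Definition tensor : Type := Quotient.quot tensor_ker.

HB.instance Definition _ := GRing.Zmodule.on tensor.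
HB.instance Definition _ := Quotient.on tensor.

Definition tensor_scale (c : k) (t : tensor) : tensor :=
  \pi_tensor (c *: repr t).

Lemma tensor_piP (x y : free) :
  \pi_tensor x = \pi_tensor y <-> tensor_rel (x - y).
Proof.
split=> [/eqP|/tensor_kerP xyP]; last by apply/eqP; rewrite -Quotient.idealrBE.
by rewrite -Quotient.idealrBE => /tensor_kerP.
Qed.

Lemma tensor_pi_add (x y : free) :
  \pi_tensor (x + y) = \pi_tensor x + \pi_tensor y.
Proof. exact: raddfD. Qed.

Lemma tensor_pi_scale c (x : free) :
  \pi_tensor (c *: x) = tensor_scale c (\pi_tensor x).
Proof.
apply/tensor_piP; rewrite -scalerBr; apply/tensor_kerP/tensor_kerZ.
by apply/tensor_kerP; apply/tensor_piP; rewrite reprK.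
Qed.

Fact tensor_scaleA a b t :
  tensor_scale a (tensor_scale b t) = tensor_scale (a * b) t.
Proof.
elim/quotW: t => x.
rewrite -(tensor_pi_scale b) -(tensor_pi_scale a) -(tensor_pi_scale _ x).
by rewrite scalerA.
Qed.

Fact tensor_scale1 : left_id 1 tensor_scale.
Proof. by elim/quotW=> x; rewrite -(tensor_pi_scale 1) scale1r. Qed.

Fact tensor_scaleDr : right_distributive tensor_scale +%R.
Proof.
move=> c; elim/quotW=> x; elim/quotW=> y.
rewrite -(tensor_pi_scale c x) -(tensor_pi_scale c y) -(tensor_pi_add x y).
by rewrite -(tensor_pi_scale c (x + y)) scalerDr tensor_pi_add.
Qed.

Fact tensor_scaleDl t : {morph tensor_scale^~ t : a b / a + b}.
Proof.
move=> a b; elim/quotW: t => x.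
rewrite -(tensor_pi_scale a x) -(tensor_pi_scale b x) -(tensor_pi_scale _ x).
by rewrite scalerDl tensor_pi_add.
Qed.

HB.instance Definition _ := GRing.Zmodule_isLmodule.Build k tensor
  tensor_scaleA tensor_scale1 tensor_scaleDr tensor_scaleDl.

Lemma tensor_piZ c (x : free) : \pi_tensor (c *: x) = c *: \pi_tensor x.
Proof. exact: tensor_pi_scale. Qed.

End Tensor.

HB.lock Definition tens (k : fieldType) (V W : lmodType k) (v : V) (w : W) :
  tensor V W := \pi_(tensor V W) << (v, w) >>.

Notation "v ⊗ w" := (tens v w) (at level 40, left associativity) : ring_scope.

(* The universal property of the tensor product, and the existence of
   decompositions into sums of pure tensors. *)
Section TensorTheory.
Context (k : fieldType) (V W : lmodType k).

Lemma tensl_linear (w : W) : linear (fun v : V => v ⊗ w).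
Proof.
move=> c v v'; rewrite tens.unlock -tensor_piZ -tensor_pi_add.
by apply/tensor_piP; apply: TensorRelL.
Qed.

Lemma tensr_linear (v : V) : linear (fun w : W => v ⊗ w).
Proof.
move=> c w w'; rewrite tens.unlock -tensor_piZ -tensor_pi_add.
by apply/tensor_piP; apply: TensorRelR.
Qed.

Lemma tensor_decomp (t : tensor V W) :
  exists s : seq (V * W), t = \sum_(p <- s) p.1 ⊗ p.2.
Proof.
elim/quotW: t => x; exists [seq (x@_p *: p.1, p.2) | p <- msupp x].
rewrite big_map [in LHS](monalgE x).
have pi0 : \pi_(tensor V W) 0 = 0 by apply: raddf0.
rewrite (big_morph _ (@tensor_pi_add _ _ _) pi0); apply: eq_bigr => -[v w] _ /=.
have tensZ c : (c *: v) ⊗ w = c *: (v ⊗ w).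
  exact: (GRing.scalable_linear (tensl_linear w)).
rewrite tensZ tens.unlock -[RHS]tensor_piZ; congr (\pi_(tensor V W) _).
by apply/malgP=> p; rewrite mcoeffZ !mcoeffU mulrnAr mulr1.
Qed.

Lemma tensor_lift (U : lmodType k) (f : V -> W -> U) :
  (forall w, linear (f^~ w)) -> (forall v, linear (f v)) ->
  exists g : {linear tensor V W -> U}, forall v w, g (v ⊗ w) = f v w.
Proof.
move=> fl fr.
pose F (x : {malg k[((V * W)%type)]}) : U :=
  \sum_(p <- msupp x) x@_p *: f p.1 p.2.
have Fw x (d : {fset (V * W)%type}) : (msupp x `<=` d)%fset ->
    F x = \sum_(p <- d) x@_p *: f p.1 p.2.
  move=> le; rewrite /F (big_fset_incl _ le) //= => p _ /mcoeff_outdom ->.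
  by rewrite scale0r.
have Flin : linear F.
  move=> c x y; pose d := (msupp x `|` msupp y)%fset.
  have lx : (msupp x `<=` d)%fset by apply: fsubsetUl.
  have ly : (msupp y `<=` d)%fset by apply: fsubsetUr.
  have lxy : (msupp (c *: x + y) `<=` d)%fset.
    apply: fsubset_trans (msuppD_le _ _) _; rewrite fsubUset ly andbT.
    exact: fsubset_trans (msuppZ_le _ _) lx.
  rewrite (Fw _ _ lx) (Fw _ _ ly) (Fw _ _ lxy) scaler_sumr -big_split /=.
  by apply: eq_bigr => p _; rewrite mcoeffD mcoeffZ scalerDl scalerA.
have F0 : F 0 = 0 by rewrite /F msupp0 big_seq_fset0.
have FB x y : F (x - y) = F x - F y.
  by rewrite [x - y]addrC -[- y]scaleN1r Flin scaleN1r addrC.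
have FU v w : F << (v, w) >> = f v w.
  by rewrite (Fw _ _ msuppU_le) big_seq_fset1 mcoeffUU scale1r.
have Frel x : tensor_rel x -> F x = 0.
  elim=> [|c {}x y _ Fx _ Fy|c v v' w|c v w w'] //.
  - by rewrite Flin Fx Fy scaler0 addr0.
  - by rewrite FB Flin !FU fl subrr.
  - by rewrite FB Flin !FU fr subrr.
pose g (t : tensor V W) : U := F (repr t).
have gpi x : g (\pi_(tensor V W) x) = F x.
  by apply/eqP; rewrite -subr_eq0 -FB; apply/eqP/Frel/tensor_piP; rewrite reprK.
have glin : linear g.
  move=> c; elim/quotW=> x; elim/quotW=> y.
  have -> : c *: \pi_(tensor V W) x + \pi_(tensor V W) y
          = \pi_(tensor V W) (c *: x + y).
    by rewrite tensor_pi_add tensor_piZ.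
  by rewrite !gpi Flin.
pose gL := GRing.isLinear.Build k _ _ _ g glin.
exists (HB.pack_for {linear tensor V W -> U} g gL) => v w.
by rewrite tens.unlock /= gpi FU.
Qed.

Lemma eq_sum_tens (U : lmodType k) (f : V -> W -> U) (s t : seq (V * W)) :
  (forall w, linear (f^~ w)) -> (forall v, linear (f v)) ->
  \sum_(p <- s) p.1 ⊗ p.2 = \sum_(p <- t) p.1 ⊗ p.2 ->
  \sum_(p <- s) f p.1 p.2 = \sum_(p <- t) f p.1 p.2.
Proof.
move=> fl fr eq_st; have [g gE] := tensor_lift fl fr.
have sumE r : \sum_(p <- r) f p.1 p.2 = g (\sum_(p <- r) p.1 ⊗ p.2).
  by rewrite linear_sum; apply: eq_bigr => p _; rewrite gE.
by rewrite !sumE eq_st.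
Qed.

End TensorTheory.

Section StronglySymmetric.
Context (k : fieldType) (V : lmodType k) (Omega : choiceType).

Definition is_basis (e : Omega -> V) : Prop :=
  (forall c : {fsfun Omega -> k with 0},
     \sum_(i <- finsupp c) c i *: e i = 0 -> forall i, c i = 0) /\
  (forall v, exists c : {fsfun Omega -> k with 0},
     v = \sum_(i <- finsupp c) c i *: e i).

Definition strongly_symmetric (e : Omega -> V) (r : tensor V V) : Prop :=
  exists c : {fsfun Omega * Omega -> k with 0},
    [/\ r = \sum_(p <- finsupp c) c p *: (e p.1 ⊗ e p.2),
        forall i j, c (i, j) = c (j, i) &
        forall i j l m, c (i, j) * c (l, m) = c (i, l) * c (j, m)].

End StronglySymmetric.

Section CYBE.
Context (k : fieldType) (L : lieAlgType k).

(* The three brackets are computed from a list s of pairs (a_i, b_i) such that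
   r = \sum_i a_i ⊗ b_i; cybe_lhs_wd shows that their sum depends on r only. *)
Definition lie_r12_r13 (s : seq (L * L)) : tensor (tensor L L) L :=
  \sum_(p <- s) \sum_(q <- s) lie p.1 q.1 ⊗ p.2 ⊗ q.2.

Definition lie_r12_r23 (s : seq (L * L)) : tensor (tensor L L) L :=
  \sum_(p <- s) \sum_(q <- s) p.1 ⊗ lie p.2 q.1 ⊗ q.2.

Definition lie_r13_r23 (s : seq (L * L)) : tensor (tensor L L) L :=
  \sum_(p <- s) \sum_(q <- s) p.1 ⊗ q.1 ⊗ lie p.2 q.2.

Definition cybe_lhs (s : seq (L * L)) : tensor (tensor L L) L :=
  lie_r12_r13 s + lie_r12_r23 s + lie_r13_r23 s.

Definition solution_of_CYBE (r : tensor L L) : Prop :=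
  forall s : seq (L * L), r = \sum_(p <- s) p.1 ⊗ p.2 -> cybe_lhs s = 0.

Lemma cybe_lhs_wd (s t : seq (L * L)) :
  \sum_(p <- s) p.1 ⊗ p.2 = \sum_(p <- t) p.1 ⊗ p.2 ->
  cybe_lhs s = cybe_lhs t.
Proof.
pose F (a b a' b' : L) : tensor (tensor L L) L :=
  lie a a' ⊗ b ⊗ b' + a ⊗ lie b a' ⊗ b' + a ⊗ a' ⊗ lie b b'.
have cybeE r : cybe_lhs r =
    \sum_(p <- r) \sum_(q <- r) F p.1 p.2 q.1 q.2.
  rewrite /cybe_lhs /lie_r12_r13 /lie_r12_r23 /lie_r13_r23 -!big_split.
  by apply: eq_bigr => p _; rewrite -!big_split.
have lin4 (T : lmodType k) (c : k) (x1 x2 x3 y1 y2 y3 : T) :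
    (c *: x1 + y1) + (c *: x2 + y2) + (c *: x3 + y3)
    = c *: (x1 + x2 + x3) + (y1 + y2 + y3).
  by rewrite [c *: x1 + y1 + _]addrACA [LHS]addrACA -!scalerDr.
have F1 b a' b' : linear (fun a => F a b a' b').
  by move=> c x y; rewrite /F lie_linearl !tensl_linear lin4.
have F2 a a' b' : linear (fun b => F a b a' b').
  move=> c x y; rewrite /F !lie_linearl.
  by rewrite 3![_ ⊗ (_ *: _ + _)]tensr_linear !tensl_linear lin4.
have F3 a b b' : linear (fun a' => F a b a' b').
  move=> c x y; rewrite /F (lie_linearr a) (lie_linearr b).
  by rewrite !tensl_linear 2!tensr_linear !tensl_linear lin4.
have F4 a b a' : linear (fun b' => F a b a' b').
  by move=> c x y; rewrite /F (lie_linearr b) 3!tensr_linear lin4.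
have lin_sum (r : seq (L * L)) (G : L * L -> L -> tensor (tensor L L) L) :
    (forall q, linear (G q)) -> linear (fun x => \sum_(q <- r) G q x).
  move=> Gl c x y; rewrite scaler_sumr -big_split.
  by apply: eq_bigr => q _; rewrite Gl.
move=> st; rewrite !cybeE.
pose G a b := \sum_(q <- s) F a b q.1 q.2.
have Gl b : linear (G^~ b) by apply: lin_sum => q; apply: F1.
have Gr a : linear (G a) by apply: lin_sum => q; apply: F2.
rewrite (eq_sum_tens Gl Gr st); apply: eq_bigr => p _.
exact: (eq_sum_tens (F3 p.1 p.2) (F4 p.1 p.2) st).
Qed.

End CYBE.

(* Main.v *)
Require Import Defs.
From mathcomp Require Import all_boot all_order all_algebra.
From mathcomp Require Import finmap.

Set Implicit Arguments.
Unset Strict Implicit.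
Unset Printing Implicit Defensive.

Import GRing.Theory.
Local Open Scope ring_scope.

(** The quadratic condition on the coefficients of a strongly symmetric tensor
    says that they form a matrix of rank at most one whose row and column
    spaces coincide, so the tensor is a scalar multiple [a *: (u ⊗ u)] of a
    square ([strongly_symmetric_square]). For such a tensor each of the three
    brackets of the Yang-Baxter equation has a factor proportional to
    [lie u u], which vanishes because the bracket is alternating
    ([square_solution_of_CYBE]). *)

Section TensorArithmetic.
Context (k : fieldType) (V W : lmodType k).

Lemma tensZl (a : k) (v : V) (w : W) : (a *: v) ⊗ w = a *: (v ⊗ w).
Proof. exact: (GRing.scalable_linear (tensl_linear w)). Qed.

Lemma tensZr (a : k) (v : V) (w : W) : v ⊗ (a *: w) = a *: (v ⊗ w).
Proof. exact: (GRing.scalable_linear (tensr_linear v)). Qed.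

Lemma tens0l (w : W) : (0 : V) ⊗ w = 0.
Proof. by rewrite -[X in X ⊗ _](scale0r 0) tensZl scale0r. Qed.

Lemma tens0r (v : V) : v ⊗ (0 : W) = 0.
Proof. by rewrite -[X in _ ⊗ X](scale0r 0) tensZr scale0r. Qed.

Lemma tensDl (v v' : V) (w : W) : (v + v') ⊗ w = v ⊗ w + v' ⊗ w.
Proof. by rewrite -[v]scale1r tensl_linear !scale1r. Qed.

Lemma tensDr (v : V) (w w' : W) : v ⊗ (w + w') = v ⊗ w + v ⊗ w'.
Proof. by rewrite -[w]scale1r tensr_linear !scale1r. Qed.

Lemma tens_suml (I : Type) (s : seq I) (F : I -> V) (w : W) :
  (\sum_(i <- s) F i) ⊗ w = \sum_(i <- s) F i ⊗ w.
Proof.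
exact: (big_morph (fun v : V => v ⊗ w) (fun v v' => tensDl v v' w) (tens0l w)).
Qed.

Lemma tens_sumr (I : Type) (s : seq I) (v : V) (F : I -> W) :
  v ⊗ (\sum_(i <- s) F i) = \sum_(i <- s) v ⊗ F i.
Proof. exact: (big_morph (tens v) (tensDr v) (tens0r v)). Qed.

End TensorArithmetic.

(** Since [finsupp c] need not be a product of two sets, this passage to a
    square of indices is what allows a double sum to be factored. *)
Lemma sum_finsupp_square (k : fieldType) (U : lmodType k) (I : choiceType)
    (c : {fsfun I * I -> k with 0}) (F : I * I -> U) :
  exists D : seq I, \sum_(p <- finsupp c) c p *: F p =
    \sum_(i <- D) \sum_(j <- D) c (i, j) *: F (i, j).
Proof.
pose D := undup (map fst (finsupp c) ++ map snd (finsupp c)).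
exists D; rewrite -(big_allpairs (F := fun p => c p *: F p)).
rewrite [RHS](bigID (mem (finsupp c))) /= [X in _ + X]big1 ?addr0 => [|p pc].
  rewrite -[RHS]big_filter; apply: perm_big; apply: uniq_perm.
  - exact: fset_uniq.
  - by rewrite filter_uniq // allpairs_uniq ?undup_uniq // => -[? ?] [? ?].
  move=> p; rewrite mem_filter; apply/idP/andP=> [pc|[]//]; split=> //.
  apply/allpairsP; exists p; rewrite !mem_undup !mem_cat.
  by rewrite !map_f ?orbT //; case: (p).
by rewrite fsfun_dflt ?scale0r.
Qed.

(** A nonzero coefficient [c (i, j)] forces [c (i, i) != 0], because
    [c (i, j) ^+ 2 = c (i, i) * c (j, j)]; then row [i] of the coefficients
    determines all of them, through
    [c (i, i) * c (l, m) = c (i, l) * c (i, m)]. *)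
Lemma strongly_symmetric_square (k : fieldType) (V : lmodType k)
    (Omega : choiceType) (e : Omega -> V) (r : tensor V V) :
  strongly_symmetric e r -> exists (a : k) (u : V), r = a *: (u ⊗ u).
Proof.
move=> [c [-> _ cM]].
have [c0|[[i j] cij]] := fset_0Vmem (finsupp c).
  by exists 0, 0; rewrite c0 big_seq_fset0 scale0r.
have cii : c (i, i) != 0.
  apply: contraTneq cij => cii0; rewrite mem_finsupp negbK.
  by rewrite -[_ == 0]orbb -mulf_eq0 cM cii0 mul0r.
have [D ->] := sum_finsupp_square c (fun p => e p.1 ⊗ e p.2).
exists (c (i, i))^-1, (\sum_(l <- D) c (i, l) *: e l).
rewrite tens_suml scaler_sumr; apply: eq_bigr => l _.
rewrite tens_sumr scaler_sumr; apply: eq_bigr => m _ /=.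
by rewrite tensZl tensZr !scalerA -mulrA -cM mulKf.
Qed.

(** The left-hand side of the equation does not depend on the decomposition
    chosen, so it may be computed from the single pair [(a *: u, u)]. *)
Lemma square_solution_of_CYBE (k : fieldType) (L : lieAlgType k) (a : k)
    (u : L) : solution_of_CYBE (a *: (u ⊗ u)).
Proof.
move=> s rs; rewrite -(@cybe_lhs_wd _ _ [:: (a *: u, u)]); last first.
  by rewrite big_seq1 tensZl.
have lie_ua : lie u (a *: u) = 0.
  have /(_ a u) -> := GRing.scalable_linear (lie_linearr u).
  by rewrite /= liexx scaler0.
rewrite /cybe_lhs /lie_r12_r13 /lie_r12_r23 /lie_r13_r23 !big_seq1 /=.
by rewrite !liexx lie_ua !(tens0l, tens0r) !addr0.
Qed.

Theorem corollary1p4 (k : fieldType) (L : lieAlgType k) (Omega : choiceType)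
    (e : Omega -> L) (r : tensor L L) :
  is_basis e -> strongly_symmetric e r -> solution_of_CYBE r.
Proof.
move=> _ /strongly_symmetric_square[a [u ->]].
exact: square_solution_of_CYBE.
Qed.
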